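(* Let $(M,\alpha)$ be a strict contact manifold and let $f,g\in\mathcal{C}^\infty(M,\mathbb{R})$. Then $$[f,g]=d\alpha(X_f,X_g)+f\,R_\alpha(g)-g\,R_\alpha(f),$$ where $[\cdot,\cdot]$ is the Jacobi bracket.
   Context: A strict contact manifold $(M,\alpha)$ is a $(2n+1)$-dimensional smooth manifold $M$ with a smooth 1-form $\alpha$ such that $\alpha\wedge(d\alpha)^n$ is nowhere zero. The Reeb vector field $R_\alpha$ is the unique vector field with $\iota_{R_\alpha}d\alpha=0$ and $\alpha(R_\alpha)=1$. For a smooth function $H$ on $M$, the contact Hamiltonian vector field $X_H$ is the unique vector field with $\alpha(X_H)=H$ and $\iota_{X_H}d\alpha=dH(R_\alpha)\alpha-dH$. The Jacobi bracket is $[f,g]=\alpha([X_f,X_g])$, with $[X_f,X_g]$ the Lie bracket of vector fields. For a vector field $X$ and a function $h$, $X(h)=dh(X)$. Exterior derivatives follow the convention $d\alpha(X,Y)=X(\alpha(Y))-Y(\alpha(X))-\alpha([X,Y])$. *)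

(* Defs.v *)
From HB Require Import structures.
From mathcomp Require Import all_boot all_order all_algebra all_fingroup ring.
From mathcomp Require Import all_classical all_reals all_analysis.

Set Implicit Arguments.
Unset Strict Implicit.
Unset Printing Implicit Defensive.

Import Order.TTheory GRing.Theory Num.Theory numFieldNormedType.Exports.

Local Open Scope classical_set_scope.
Local Open Scope ring_scope.

Section SmoothEuclidean.
Variables (R : realType) (m : nat).
Implicit Types (U : set 'rV[R]_m) (f g : 'rV[R]_m -> R).

(* All iterated partial derivatives of order <= k exist and are continuous on
   U; only meaningful for U open, where the values of f off U are irrelevant. *)
Fixpoint Ck (k : nat) U f : Prop :=
  {in U, continuous f} /\
  if k is k'.+1 then
    forall i : 'I_m,
      (forall x, U x -> derivable f x (delta_mx 0 i)) /\
      Ck k' U ('D_(delta_mx 0 i) f)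
  else True.

Definition smooth_on U f : Prop := forall k, Ck k U f.

Lemma Ck_continuous k U f : Ck k U f -> {in U, continuous f}.
Proof. by case: k => [|k] []. Qed.

Lemma CkW k U f : Ck k.+1 U f -> Ck k U f.
Proof.
elim: k f => [|k IH] f; first by case.
by case=> cf Hf; split=> // i; have [df /IH] := Hf i.
Qed.

Lemma eq_Ck k U f g : open U -> (forall x, U x -> f x = g x) ->
  Ck k U f -> Ck k U g.
Proof.
move=> oU; have nfg h h' x : (forall y, U y -> h y = h' y) -> U x ->
    \forall y \near x, h y = h' y :> R.
  move=> hh' Ux; move: (open_nbhs_nbhs (conj oU Ux)).
  by apply: filterS => y; exact: hh'.
have cfg h h' : (forall y, U y -> h y = h' y) ->
    {in U, continuous h} -> {in U, continuous (h' : _ -> R)}.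
  move=> hh' ch x xU; have Ux : U x by rewrite inE in xU.
  rewrite /continuous_at -(hh' _ Ux).
  exact: cvg_trans (near_eq_cvg (nfg _ _ _ hh' Ux)) (ch x xU).
elim: k f g => [|k IH] f g fg [cf Hf]; first by split=> //; exact: cfg _ _ fg cf.
split=> [|i]; first exact: cfg _ _ fg cf.
have [df Dk] := Hf i.
split=> [x Ux|]; first exact: (near_eq_derivable (nfg _ _ _ fg Ux) (df x Ux)).
by apply: IH Dk => x Ux; exact: (near_eq_derive _ (nfg _ _ _ fg Ux)).
Qed.

Lemma Ck_cst k U (a : R) : Ck k U (cst a).
Proof.
have cC b : {in U, continuous (cst b : 'rV[R]_m -> R)}.
  by move=> x _; exact: cst_continuous.
elim: k a => [|k IH] a; first by split=> //; exact: cC.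
split=> [|i]; first exact: cC.
split=> [x _|]; first exact: derivable_cst.
rewrite (_ : 'D_(delta_mx 0 i) (cst a) = cst 0); first exact: IH.
by apply/funext => x; rewrite derive_cst.
Qed.

Lemma CkD k U f g : open U -> Ck k U f -> Ck k U g -> Ck k U (f \+ g).
Proof.
move=> oU; elim: k f g => [|k IH] f g Hf Hg.
  by split=> // x Ux; exact: (cvgD (Ck_continuous Hf Ux) (Ck_continuous Hg Ux)).
case: Hf Hg => [cf Hf] [cg Hg]; split.
  by move=> x Ux; exact: (cvgD (cf x Ux) (cg x Ux)).
move=> i; have [df Df] := Hf i; have [dg Dg] := Hg i; split.
  by move=> x Ux; exact: (derivableD (df x Ux) (dg x Ux)).
apply: eq_Ck oU _ (IH _ _ Df Dg) => x Ux.
by rewrite -[RHS]/('D_(delta_mx 0 i) (f + g) x) (deriveD (df x Ux) (dg x Ux)).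
Qed.

Lemma CkM k U f g : open U -> Ck k U f -> Ck k U g -> Ck k U (f \* g).
Proof.
move=> oU; elim: k f g => [|k IH] f g Hf Hg.
  by split=> // x Ux; exact: (cvgM (Ck_continuous Hf Ux) (Ck_continuous Hg Ux)).
have Hf' := CkW Hf; have Hg' := CkW Hg.
case: Hf Hg => [cf Hf] [cg Hg]; split.
  by move=> x Ux; exact: (cvgM (cf x Ux) (cg x Ux)).
move=> i; have [df Df] := Hf i; have [dg Dg] := Hg i; split.
  by move=> x Ux; exact: (derivableM (df x Ux) (dg x Ux)).
apply: eq_Ck oU _ (CkD oU (IH _ _ Hf' Dg) (IH _ _ Hg' Df)) => x Ux.
by rewrite -[RHS]/('D_(delta_mx 0 i) (f * g) x) (deriveM (df x Ux) (dg x Ux)).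
Qed.

End SmoothEuclidean.

Section Manifold.
Variables (R : realType) (m : nat).

(* A homeomorphism from an open subset of M onto an open subset of R^m; both
   directions are total functions with junk values off these open sets. *)
Record chart (M : topologicalType) := Chart {
  chart_dom : set M;
  chart_codom : set 'rV[R]_m;
  chart_fun :> M -> 'rV[R]_m;
  chart_inv : 'rV[R]_m -> M;
  chart_dom_open : open chart_dom;
  chart_codom_open : open chart_codom;
  chart_funP : forall p, chart_dom p -> chart_codom (chart_fun p);
  chart_invP : forall x, chart_codom x -> chart_dom (chart_inv x);
  chart_funK : forall p, chart_dom p -> chart_inv (chart_fun p) = p;
  chart_invK : forall x, chart_codom x -> chart_fun (chart_inv x) = x;
  chart_fun_continuous : {in chart_dom, continuous chart_fun};
  chart_inv_continuous : {in chart_codom, continuous chart_inv}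
}.

Definition smooth_transition (M : topologicalType) (phi psi : chart M) : Prop :=
  forall j : 'I_m,
    smooth_on (phi @` (chart_dom phi `&` chart_dom psi))
              (fun x => psi (chart_inv phi x) 0 j).

Record smooth_manifold := SmoothManifold {
  manifold_sort :> topologicalType;
  manifold_hausdorff : hausdorff_space manifold_sort;
  manifold_second_countable : @second_countable manifold_sort;
  atlas : set (chart manifold_sort);
  atlas_cover : forall p, exists2 phi, atlas phi & chart_dom phi p;
  atlas_compatible : forall phi psi, atlas phi -> atlas psi ->
    smooth_transition phi psi
}.

End Manifold.

Section SmoothFunctions.
Variables (R : realType) (m : nat) (M : smooth_manifold R m).

Definition smooth (f : M -> R) : Prop :=
  forall phi, atlas phi -> smooth_on (chart_codom phi) (f \o chart_inv phi).

Definition is_smooth : {pred M -> R} := fun f => `[< smooth f >].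

Lemma is_smoothP f : reflect (smooth f) (f \in is_smooth).
Proof. exact: asboolP. Qed.

Lemma smooth_subring : subring_closed is_smooth.
Proof.
have sC a : smooth (cst a) by move=> phi _ k; exact: Ck_cst.
have sD f g : smooth f -> smooth g -> smooth (f + g).
  by move=> sf sg phi aphi k;
    exact: (CkD (@chart_codom_open _ _ _ phi) (sf _ aphi k) (sg _ aphi k)).
have sM f g : smooth f -> smooth g -> smooth (f * g).
  by move=> sf sg phi aphi k;
    exact: (CkM (@chart_codom_open _ _ _ phi) (sf _ aphi k) (sg _ aphi k)).
split.
- by apply/is_smoothP; exact: sC.
- move=> f g /is_smoothP sf /is_smoothP sg; apply/is_smoothP; apply: sD => //.
  rewrite (_ : - g = cst (-1) * g); first exact: sM.
  by apply/funext => x; rewrite /GRing.mul /= /cst mulN1r.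
- by move=> f g /is_smoothP sf /is_smoothP sg; apply/is_smoothP; exact: sM.
Qed.

HB.instance Definition _ := GRing.isSubringClosed.Build (M -> R) is_smooth
  smooth_subring.

Lemma smooth_scaler : scaler_closed is_smooth.
Proof.
move=> a f sf; rewrite (_ : a *: f = cst a * f); last exact/funext.
by apply: rpredM => //; apply/is_smoothP => phi _ k; exact: Ck_cst.
Qed.

HB.instance Definition _ := GRing.isScaleClosed.Build R (M -> R) is_smooth
  smooth_scaler.

Record Cinfty := MkCinfty {
  Cinfty_fun :> M -> R;
  Cinfty_smooth : Cinfty_fun \in is_smooth
}.

HB.instance Definition _ := [isSub for Cinfty_fun].
HB.instance Definition _ := [Choice of Cinfty by <:].
HB.instance Definition _ := GRing.SubChoice_isSubComPzRing.Build
  (M -> R) is_smooth Cinfty smooth_subring.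
HB.instance Definition _ := [SubZmodule_isSubLmodule of Cinfty by <:].

Definition mkCinfty (f : M -> R) (sf : smooth f) : Cinfty :=
  MkCinfty (introT (is_smoothP f) sf).

End SmoothFunctions.

Section VectorFields.
Variables (R : realType) (m : nat) (M : smooth_manifold R m).
Implicit Types (f g h : Cinfty M) (p : M).

Definition derivation_at p (v : Cinfty M -> R) : Prop :=
  (forall (a : R) f g, v (a *: f + g) = a * v f + v g) /\
  (forall f g, v (f * g) = f p * v g + v f * g p).

Definition is_derivation_at p : {pred Cinfty M -> R} :=
  fun v => `[< derivation_at p v >].

Lemma derivation_at_submod p : submod_closed (is_derivation_at p).
Proof.
split=> [|a v w /asboolP[vL vM] /asboolP[wL wM]]; apply/asboolP; split.
- by move=> a f g; rewrite /GRing.zero /= mulr0 addr0.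
- by move=> f g; rewrite /GRing.zero /= mulr0 mul0r addr0.
- move=> b f g; have E h : (a *: v + w) h = a * v h + w h by [].
  by rewrite !E vL wL; ring.
- move=> f g; have E h : (a *: v + w) h = a * v h + w h by [].
  by rewrite !E vM wM; ring.
Qed.

HB.instance Definition _ p := GRing.isSubmodClosed.Build R (Cinfty M -> R)
  (is_derivation_at p) (derivation_at_submod p).

(* Tangent vectors at p are derivations at p of the algebra of globally defined
   smooth functions; equivalent to derivations of germs, M being Hausdorff and
   second countable. *)
Record tangent p := Tangent {
  tangent_fun :> Cinfty M -> R;
  tangent_derivation : tangent_fun \in is_derivation_at p
}.

HB.instance Definition _ p := [isSub for @tangent_fun p].
HB.instance Definition _ p := [Choice of tangent p by <:].
HB.instance Definition _ p := [SubChoice_isSubLmodule of tangent p by <:].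

(* A smooth section of the tangent bundle, smoothness being tested on smooth
   functions. *)
Record vector_field := VectorField {
  vector_field_at :> forall p, tangent p;
  vector_field_smooth : forall f, smooth (fun p => vector_field_at p f)
}.

(* A smooth section of the cotangent bundle, smoothness being tested on smooth
   vector fields. *)
Record one_form := OneForm {
  one_form_at :> forall p, {scalar tangent p};
  one_form_smooth : forall X : vector_field,
    smooth (fun p => one_form_at p (X p))
}.

Definition one_form_apply (alpha : one_form) (X : vector_field) : Cinfty M :=
  mkCinfty (one_form_smooth alpha X).

Definition differential_at h p (v : tangent p) : R := v h.

Lemma differential_at_linear h p : scalar (@differential_at h p).
Proof. by []. Qed.

HB.instance Definition _ h p := GRing.isLinear.Build R (tangent p) R *%R
  (@differential_at h p) (@differential_at_linear h p).

Definition differential h : one_form :=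
  OneForm (one_form_at := fun p => @differential_at h p)
          (fun X => vector_field_smooth X h).

Definition derive_along (X : vector_field) h : Cinfty M :=
  one_form_apply (differential h) X.

Definition lie_bracket_fun (X Y : vector_field) p : Cinfty M -> R := fun h =>
  X p (derive_along Y h) - Y p (derive_along X h).

Lemma lie_bracket_derivation X Y p :
  lie_bracket_fun X Y p \in is_derivation_at p.
Proof.
have DL (Z : vector_field) a f g :
    derive_along Z (a *: f + g) = a *: derive_along Z f + derive_along Z g.
  apply/val_inj/funext => q; rewrite /= /differential_at.
  by have /asboolP[-> _] := tangent_derivation (Z q).
have DM (Z : vector_field) f g :
    derive_along Z (f * g) = f * derive_along Z g + derive_along Z f * g.
  apply/val_inj/funext => q; rewrite /= /differential_at.
  by have /asboolP[_ ->] := tangent_derivation (Z q).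
have TD (Z : vector_field) q f g : Z q (f + g) = Z q f + Z q g.
  have /asboolP[ZL _] := tangent_derivation (Z q).
  by have := ZL 1 f g; rewrite scale1r mul1r.
apply/asboolP; split; rewrite /lie_bracket_fun.
  move=> a f g; rewrite !DL.
  have /asboolP[-> _] := tangent_derivation (X p).
  have /asboolP[-> _] := tangent_derivation (Y p).
  ring.
move=> f g; rewrite !DM !TD.
have /asboolP[_ XM] := tangent_derivation (X p).
have /asboolP[_ YM] := tangent_derivation (Y p).
rewrite !XM !YM /= /differential_at; ring.
Qed.

Lemma lie_bracket_smooth X Y h : smooth (fun p => lie_bracket_fun X Y p h).
Proof.
apply/is_smoothP.
exact: (Cinfty_smooth (derive_along X (derive_along Y h) -
                       derive_along Y (derive_along X h))).
Qed.

Definition lie_bracket (X Y : vector_field) : vector_field :=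
  VectorField (vector_field_at := fun p => Tangent (lie_bracket_derivation X Y p))
              (fun h => lie_bracket_smooth X Y h).

(* k-forms are represented by their values on k-tuples of vector fields; the
   alternating C^oo(M)-multilinear ones are the differential k-forms. *)
Definition form (k : nat) := ('I_k -> vector_field) -> Cinfty M.

Definition form_of_one_form (alpha : one_form) : form 1 :=
  fun X => one_form_apply alpha (X ord0).

Definition ext_derivative (alpha : one_form) (X Y : vector_field) : Cinfty M :=
  derive_along X (one_form_apply alpha Y) - derive_along Y (one_form_apply alpha X)
  - one_form_apply alpha (lie_bracket X Y).

Definition form_of_ext_derivative (alpha : one_form) : form 2 :=
  fun X => ext_derivative alpha (X ord0) (X ord_max).

(* Normalised so that (a /\ b)(X, Y) = a(X) b(Y) - a(Y) b(X) on 1-forms. *)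
Definition wedge_product (k l : nat) (omega : form k) (eta : form l) :
    form (k + l)%N :=
  fun X => (k`!%:R * l`!%:R)^-1 *:
    \sum_(s : 'S_(k + l)%N) (-1) ^+ s *
       (omega (fun i => X (s (lshift l i))) *
        eta (fun j => X (s (rshift k j)))).

Fixpoint wedge_power (k : nat) (omega : form k) (n : nat) : form (n * k)%N :=
  if n is n'.+1 return form (n * k)%N
  then wedge_product omega (@wedge_power k omega n')
  else fun=> 1.

(* When omega is C^oo(M)-multilinear, (omega X) p depends only on the vectors
   X i p, so this says that omega_p is nonzero at every p. *)
Definition nowhere_zero (k : nat) (omega : form k) : Prop :=
  forall p, exists X : 'I_k -> vector_field, omega X p != 0.

Definition is_reeb (alpha : one_form) (Reeb : vector_field) : Prop :=
  (forall Y, ext_derivative alpha Reeb Y = 0) /\ one_form_apply alpha Reeb = 1.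

Definition is_contact_hamiltonian (alpha : one_form) (Reeb : vector_field)
    (H : Cinfty M) (X : vector_field) : Prop :=
  one_form_apply alpha X = H /\
  forall Y, ext_derivative alpha X Y =
    one_form_apply (differential H) Reeb * one_form_apply alpha Y -
    one_form_apply (differential H) Y.

(* The bracket of two functions f and g, where Xf and Xg are the contact
   Hamiltonian vector fields of f and g. *)
Definition jacobi_bracket (alpha : one_form) (Xf Xg : vector_field) : Cinfty M :=
  one_form_apply alpha (lie_bracket Xf Xg).

End VectorFields.

Arguments wedge_product {R m M k l} omega eta.
Arguments wedge_power {R m M k} omega n.

Definition contact_form (R : realType) (n : nat)
    (M : smooth_manifold R (2 * n + 1)%N) (alpha : one_form M) : Prop :=
  nowhere_zero (wedge_product (form_of_one_form alpha)
                              (wedge_power (form_of_ext_derivative alpha) n)).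

(* Main.v *)
Require Import Defs.
From mathcomp Require Import all_boot all_order all_algebra.
From mathcomp Require Import all_classical all_reals all_analysis.
From mathcomp Require Import ring.

(** The exterior derivative, evaluated on the two contact Hamiltonian fields,
    reads [d alpha(X_f, X_g) = X_f(g) - X_g(f) - [f, g]], because
    [alpha(X_f) = f] and [alpha(X_g) = g].  The defining equations of [X_f] and
    [X_g] turn the two derivatives into values of [d alpha]:
    - [d alpha(X_f, X_g) = Reeb(f) g - X_g(f)], from [X_f] contracted with [X_g];
    - [d alpha(X_g, X_f) = Reeb(g) f - X_f(g)], from [X_g] contracted with [X_f].
    Since [d alpha] is alternating ([ext_derivative_antisym]), the second one
    gives [X_f(g) = d alpha(X_f, X_g) + f Reeb(g)], and substituting both leaves
    [[f, g] = (2 - 1) d alpha(X_f, X_g) + f Reeb(g) - g Reeb(f)]. *)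

Set Implicit Arguments.
Unset Strict Implicit.
Unset Printing Implicit Defensive.

Import Order.TTheory GRing.Theory Num.Theory.

Local Open Scope ring_scope.

Section ExteriorDerivative.
Variables (R : realType) (m : nat) (M : smooth_manifold R m).
Implicit Types (alpha : one_form M) (X Y : vector_field M).

(** Stated at each point, in the tangent space, because this is where a one-form
    is linear and the sign can be pulled out of it. *)
Lemma lie_bracket_antisym X Y p : lie_bracket Y X p = - lie_bracket X Y p.
Proof. by apply/val_inj/funext => h; rewrite /= /lie_bracket_fun -opprB. Qed.

Lemma ext_derivative_antisym alpha X Y :
  ext_derivative alpha Y X = - ext_derivative alpha X Y.
Proof.
have bracketN : one_form_apply alpha (lie_bracket Y X) =
                - one_form_apply alpha (lie_bracket X Y).
  apply/val_inj/funext => p.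
  by rewrite -[LHS]/(alpha p (lie_bracket Y X p)) lie_bracket_antisym linearN.
by rewrite /ext_derivative bracketN; ring.
Qed.

End ExteriorDerivative.

Theorem proposition3p1p10 (R : realType) (n : nat)
    (M : smooth_manifold R (2 * n + 1)%N)
    (alpha : one_form M) (halpha : contact_form alpha)
    (Reeb : vector_field M) (hReeb : is_reeb alpha Reeb)
    (f g : Cinfty M) (Xf Xg : vector_field M)
    (hXf : is_contact_hamiltonian alpha Reeb f Xf)
    (hXg : is_contact_hamiltonian alpha Reeb g Xg) :
  jacobi_bracket alpha Xf Xg =
    ext_derivative alpha Xf Xg + f * derive_along Reeb g
    - g * derive_along Reeb f.
Proof.
case: hXf hXg => [alphaXf dalphaXf] [alphaXg dalphaXg].
have Xg_f : derive_along Xg f =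
    derive_along Reeb f * g - ext_derivative alpha Xf Xg.
  by rewrite dalphaXf alphaXg /derive_along; ring.
have Xf_g : derive_along Xf g =
    derive_along Reeb g * f + ext_derivative alpha Xf Xg.
  by rewrite -[ext_derivative _ _ _]opprK -ext_derivative_antisym dalphaXg
             alphaXf /derive_along; ring.
have bracketE : jacobi_bracket alpha Xf Xg =
    derive_along Xf g - derive_along Xg f - ext_derivative alpha Xf Xg.
  by rewrite /ext_derivative alphaXf alphaXg /jacobi_bracket; ring.
by rewrite bracketE Xg_f Xf_g; ring.
Qed.
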